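(* Let $n\ge 7$ and $2\le k\le\lfloor n/2\rfloor$ be integers. Then for every $R\in\mathbb{R}\setminus\{1\}$ there exist $\alpha,\beta,\gamma,\delta>0$ and a balanced $(n,k;\alpha,\beta,\gamma,\delta)$-two-chunk cyclic metric space $X$ such that $$\lim_{t\to0^+}\mathrm{Mag}(tX)=R.$$
   Context: Magnitude: for a finite metric space $(X,d)$ with $X=\{x_1,\dots,x_m\}$, the zeta matrix is $Z_X=(e^{-d(x_i,x_j)})_{1\le i,j\le m}$. A weighting is a vector $w\in\mathbb{R}^m$ with $Z_Xw=(1,\dots,1)^T$. If a weighting exists, the magnitude is $\mathrm{Mag}(X)=\sum_{i=1}^m w_i$ for any weighting $w$ (independent of the choice, since $Z_X$ is symmetric); it is not required that $Z_X$ be invertible. For $t>0$, $tX$ denotes the metric space $(X,td)$. A limit as $t\to0^+$ of $\mathrm{Mag}(tX)$ refers to $\mathrm{Mag}(tX)$ being defined for all sufficiently small $t>0$. A distance matrix is a real symmetric matrix with zero diagonal, strictly positive off-diagonal entries, and entries satisfying all triangle inequalities $D_{ij}\le D_{i\ell}+D_{\ell j}$; it generates a finite metric space on its index set. Two-chunk cyclic spaces: for integers $n\ge 2$, $1\le k\le\lfloor n/2\rfloor$ and reals $\alpha,\beta,\gamma,\delta>0$, the $(n,k;\alpha,\beta,\gamma,\delta)$-two-chunk cyclic matrix $D_{n,k}(\alpha,\beta,\gamma,\delta)$ is the symmetric $2n\times 2n$ matrix indexed by $\{a_0,\dots,a_{n-1}\}\sqcup\{b_0,\dots,b_{n-1}\}$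 with $D(a_i,a_i)=D(b_i,b_i)=0$, $D(a_i,a_j)=\alpha$ and $D(b_i,b_j)=\beta$ for $i\ne j$, and $D(a_i,b_j)=D(b_j,a_i)=\gamma$ if $j\equiv i+s\pmod n$ for some $s\in\{0,1,\dots,k-1\}$, and $=\delta$ otherwise. When this matrix is a distance matrix, the metric space it generates is called an $(n,k;\alpha,\beta,\gamma,\delta)$-two-chunk cyclic metric space and is denoted $X_{n,k}(\alpha,\beta,\gamma,\delta)$. Balanced condition: such a space is called balanced if $2\bigl(k\gamma+(n-k)\delta\bigr)=(n-1)(\alpha+\beta)$. *)

(* Defs.v *)
From HB Require Import structures.
From mathcomp Require Import all_boot all_order all_algebra.
From mathcomp Require Import all_classical all_reals all_analysis.

Set Implicit Arguments.
Unset Strict Implicit.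
Unset Printing Implicit Defensive.

Import Order.TTheory GRing.Theory Num.Theory.
Import numFieldNormedType.Exports.

Local Open Scope classical_set_scope.
Local Open Scope ring_scope.

(* A finite metric space is represented by its distance matrix D : 'M_m, with
   points 'I_m; the rescaled space tX is then represented by t *: D. *)

Definition is_distance_matrix (R : realType) (m : nat) (D : 'M[R]_m) : Prop :=
  [/\ forall i j, D i j = D j i,
      forall i, D i i = 0,
      forall i j, i != j -> 0 < D i j
    & forall i j l, D i j <= D i l + D l j].

Definition zeta_mx (R : realType) (m : nat) (D : 'M[R]_m) : 'M[R]_m :=
  \matrix_(i, j) expR (- D i j).

Definition is_weighting (R : realType) (m : nat) (D : 'M[R]_m) (w : 'cV[R]_m)
    : Prop :=
  zeta_mx D *m w = const_mx 1.

Definition has_magnitude (R : realType) (m : nat) (D : 'M[R]_m) : Prop :=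
  exists w : 'cV[R]_m, is_weighting D w.

(* Meaningful only when [has_magnitude D]; the junk value is 0 otherwise. *)
Definition magnitude (R : realType) (m : nat) (D : 'M[R]_m) : R :=
  \sum_i (xget 0 [set w : 'cV[R]_m | is_weighting D w]) i ord0.

Lemma magnitudeE (R : realType) (m : nat) (D : 'M[R]_m) (w : 'cV[R]_m) :
  (forall i j, D i j = D j i) -> is_weighting D w ->
  magnitude D = \sum_i w i ord0.
Proof.
move=> Dsym wP; rewrite /magnitude; case: xgetP => [v _ /= vP|/(_ w)//].
have Zsym : (zeta_mx D)^T = zeta_mx D.
  by apply/matrixP => i j; rewrite !mxE Dsym.
have sumE (u : 'cV[R]_m) :
    ((const_mx 1 : 'cV[R]_m)^T *m u) ord0 ord0 = \sum_i u i ord0.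
  by rewrite mxE; apply: eq_bigr => i _; rewrite !mxE mul1r.
rewrite -!sumE -[in LHS]wP trmx_mul Zsym -mulmxA vP.
by rewrite !mxE; apply: eq_bigr => i _; rewrite !mxE mulr1 mul1r.
Qed.

Definition magnitude_limit0 (R : realType) (m : nat) (D : 'M[R]_m) (r : R)
    : Prop :=
  (\forall t \near 0^'+, has_magnitude (t *: D)) /\
  magnitude (t *: D) @[t --> 0^'+] --> r.

(* Rows and columns are split as n + n: lshift _ i is a_i, rshift _ i is b_i. *)
Definition two_chunk_cyclic_mx (R : realType) (n k : nat)
    (alpha beta gamma delta : R) : 'M[R]_(n + n) :=
  let cross : 'M[R]_n := \matrix_(i, j)
    (if [exists s : 'I_k, (j : nat) == i + s %[mod n]] then gamma else delta) in
  block_mx (\matrix_(i, j) (if i == j then 0 else alpha)) cross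
           cross^T (\matrix_(i, j) (if i == j then 0 else beta)).

Definition balanced (R : realType) (n k : nat) (alpha beta gamma delta : R)
    : Prop :=
  2 * (k%:R * gamma + (n%:R - k%:R) * delta) = (n%:R - 1) * (alpha + beta).

(* Main.v *)
Require Import Defs.
From HB Require Import structures.
From mathcomp Require Import all_boot all_order all_algebra.
From mathcomp Require Import all_classical all_reals all_analysis.
From mathcomp Require Import ring lra.
Import Order.TTheory GRing.Theory Num.Theory.
Import numFieldNormedType.Exports.
Local Open Scope classical_set_scope.
Local Open Scope ring_scope.

(** In a two-chunk cyclic space every point a_i sees the same distances, and
    so does every b_j, so there is a weighting constant on each chunk. With
      A = 1 + (n-1) e^(-t alpha),  B = 1 + (n-1) e^(-t beta),
      C = k e^(-t gamma) + (n-k) e^(-t delta),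
    solving a 2 x 2 linear system gives Mag(tX) = n (A + B - 2C) / (AB - C^2)
    as soon as AB - C^2 is nonzero ([two_chunk_magnitude]).

    The balanced condition says exactly that the terms of order t cancel in
    A + B - 2C, hence also in AB - C^2. Numerator and denominator are then both
    of order t^2, and the second-order expansion of the exponential gives the
    limit n p / (n p - s^2/4), where
      p = (n-1)(alpha^2 + beta^2)/2 - (k gamma^2 + (n-k) delta^2),
      s = (n-1)(alpha - beta),
    whenever that denominator is nonzero ([two_chunk_magnitude_limit0]).

    Normalize alpha = 1 + x, beta = 1 - x and put z = gamma - delta; balance then
    determines gamma and delta, and the limit becomes
      1 + (n-1)^2 x^2 / ((n-1)(1 + x^2) - k(n-k) z^2).
    A target r asks for the denominator (n-1)^2 x^2/(r-1). This may have either
    sign and tends to 0 with x, so for x small there is a z realizing it, as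
    near as desired to z0 = sqrt((n-1)/(k(n-k))); only r = 1 is excluded.

    The triangle inequalities have room around x = 0, z = z0. The inequality
    gamma <= beta + delta amounts to z <= 1 - x, and z0 < 1 because k >= 2.
    The inequality alpha <= 2 delta follows at
    x = 0 from 2 k z0 <= 2 sqrt(n-1) < n - 2, that is from n^2 - 8n + 8 > 0,
    which is where n >= 7 enters. [exists_parameters] makes this quantitative. *)

(** * Second-order expansion of the exponential at 0 *)

Lemma cvg_expRNM (R : realType) (c : R) :
  expR (- (t * c)) @[t --> 0^'+] --> (1 : R).
Proof.
apply: cvg_at_right_filter.
rewrite -[X in _ --> X](@expR0 R) -[X in expR X](_ : - (0 * c) = 0); last first.
  by rewrite mul0r oppr0.
apply: continuous_cvg; first exact: continuous_expR.
by apply: cvgN; apply: cvgMr_tmp; exact: cvg_id.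
Qed.

Lemma is_derive_expRNM (R : realType) (c t : R) :
  is_derive t 1 (fun u => expR (- (u * c))) (- c * expR (- (t * c))).
Proof.
have h : is_derive t 1 (fun u : R => - (u * c)) (- c).
  have -> : (fun u : R => - (u * c)) = (fun u => u * - c).
    by apply/funext => u; rewrite mulrN.
  apply: is_derive_eq; rewrite scaler0 add0r; exact: mulr1.
have := @is_derive1_comp R expR (fun u : R => - (u * c)) t _ _ (is_derive_expR _) h.
by rewrite mulrC.
Qed.

Lemma expRNM_slope (R : realType) (c : R) :
  (expR (- (t * c)) - 1) / t @[t --> 0^'+] --> - c.
Proof.
apply: (@lhopital_at_right R (fun t => expR (- (t * c)) - 1)
  (fun t => - c * expR (- (t * c))) id (fun=> 1) 0 1 (- c)) => //.
- move=> t _; rewrite -[X in is_derive _ _ _ X]subr0.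
  by apply: is_deriveB; exact: is_derive_expRNM.
- rewrite -[X in _ --> X](subrr 1); apply: cvgB; last exact: cvg_cst.
  exact: cvg_expRNM.
- by apply: cvg_at_right_filter; exact: cvg_id.
- have -> : (fun t : R => - c * expR (- (t * c)) / 1) =
    (fun t => - c * expR (- (t * c))) by apply/funext => t; rewrite divr1.
  rewrite -[X in _ --> X]mulr1; apply: cvgM; first exact: cvg_cst.
  exact: cvg_expRNM.
Qed.

(** One application of l'Hopital's rule reduces this to [expRNM_slope]. *)
Lemma expRNM_second_order (R : realType) (c : R) :
  (expR (- (t * c)) - 1 + t * c) / t ^+ 2 @[t --> 0^'+] --> c ^+ 2 / 2.
Proof.
have cid : (t : R) @[t --> 0^'+] --> (0 : R).
  by apply: cvg_at_right_filter; exact: cvg_id.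
apply: (@lhopital_at_right R (fun t => expR (- (t * c)) - 1 + t * c)
  (fun t => - c * expR (- (t * c)) - 0 + c) (fun t => t ^+ 2) (fun t => 2 * t) 0 1) => //.
- move=> t _; apply: is_deriveD.
    by apply: is_deriveB; exact: is_derive_expRNM.
  apply: is_derive_eq; rewrite scaler0 add0r; exact: mulr1.
- move=> t _; apply: is_derive_eq; rewrite [LHS](_ : _ = t * 1 + t * 1)//; ring.
- rewrite -[X in _ --> X](_ : 1 - 1 + 0 * c = 0); last by ring.
  apply: cvgD; last by apply: cvgMr_tmp.
  by apply: cvgB; [exact: cvg_expRNM|exact: cvg_cst].
- rewrite -[X in _ --> X](_ : 0 * 0 = 0 :> R); last by ring.
  exact: cvgM.
- by move=> t; rewrite in_itv/= => /andP[t0 _]; rewrite mulf_neq0// gt_eqF.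
- (* The quotient of derivatives is -c/2 times the slope of the exponential. *)
  have -> : c ^+ 2 / 2 = - (c / 2) * - c by field.
  have : - (c / 2) * ((expR (- (t * c)) - 1) / t) @[t --> 0^'+] --> - (c / 2) * - c.
    by apply: cvgM; [exact: cvg_cst|exact: expRNM_slope].
  apply: cvg_trans; apply: near_eq_cvg; near=> t.
  have t0 : t != 0 by rewrite gt_eqF.
  by field.
Unshelve. all: by end_near. Qed.

(** * The cyclic incidence pattern *)

Definition arc (n k i j : nat) := [exists s : 'I_k, j == i + s %[mod n]].

Lemma card_arc n k (i : 'I_n) :
  (k <= n)%N -> #|[pred j : 'I_n | arc n k i j]| = k.
Proof.
move=> kn; have n0 : (0 < n)%N by case: n i {kn} => [[]|].
pose f (s : 'I_k) : 'I_n := Ordinal (ltn_pmod (i + s) n0).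
have finj : injective f.
  move=> s s' /(congr1 val)/=/eqP; rewrite eqn_modDl !modn_small.
  - by move=> /eqP/val_inj.
  - exact: leq_trans kn.
  - exact: leq_trans kn.
rewrite -[RHS]card_ord -(card_codom finj); apply: eq_card => j.
rewrite !inE; apply/existsP/codomP => -[s].
  by move=> /eqP js; exists s; apply: val_inj; rewrite /= -js modn_small.
by move=> ->; exists s; rewrite /= modn_mod.
Qed.

(** The pattern is regular on columns as well as on rows: the indices i whose
    arc contains j are the j - s for s < k, written j + (n - s) to stay in the
    natural numbers. This makes the weights on the b_j equal. *)
Lemma card_arcV n k (j : 'I_n) :
  (k <= n)%N -> #|[pred i : 'I_n | arc n k i j]| = k.
Proof.
move=> kn; have n0 : (0 < n)%N by case: n j {kn} => [[]|].
have sn (s : 'I_k) : (s <= n)%N by apply: ltnW; apply: leq_trans kn.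
pose f (s : 'I_k) : 'I_n := Ordinal (ltn_pmod (j + (n - s)) n0).
have fE (s : 'I_k) (i : 'I_n) : (j == i + s %[mod n]) = (i == f s).
  rewrite -val_eqE/= -[in RHS](modn_small (ltn_ord i)) -(eqn_modDr (n - s)).
  by rewrite -addnA subnKC// modnDr eq_sym.
have finj : injective f.
  move=> s s' fs; have := fE s (f s); rewrite eqxx => /eqP js.
  have := fE s' (f s); rewrite fs eqxx -fs js eqn_modDl => /eqP.
  by rewrite !modn_small ?(leq_trans _ kn)// => /val_inj.
rewrite -[RHS]card_ord -(card_codom finj); apply: eq_card => i.
rewrite !inE; apply/existsP/codomP => -[s].
  by rewrite fE => /eqP; exists s.
by move=> i_s; exists s; rewrite fE i_s.
Qed.

Lemma sum_if_const (R : realType) (T : finType) (P : pred T) (a b : R) :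
  \sum_j (if P j then a else b) = #|P|%:R * a + (#|T|%:R - #|P|%:R) * b.
Proof.
rewrite (bigID P)/= (eq_bigr (fun=> a)); last by move=> ? ->.
rewrite [X in _ + X](eq_bigr (fun=> b)); last by move=> ? /negbTE ->.
rewrite !sumr_const -[a *+ _]mulr_natl -[b *+ _]mulr_natl; congr (_ + _ * _).
by rewrite -(cardC P) natrD addrC addKr; congr _%:R; apply: eq_card.
Qed.

(** * Magnitude of a two-chunk cyclic space *)

(** The sum over one row of the zeta matrix at scale t, restricted to the chunk
    of the row itself. *)
Definition self_sum {R : realType} (n : nat) (alpha t : R) :=
  1 + (n%:R - 1) * expR (- (t * alpha)).

(** The sum over one row of the zeta matrix at scale t, restricted to the
    opposite chunk. *)
Definition cross_sum {R : realType} (n k : nat) (gamma delta t : R) :=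
  k%:R * expR (- (t * gamma)) + (n%:R - k%:R) * expR (- (t * delta)).

Section Magnitude.
Context {R : realType} (n k : nat) (alpha beta gamma delta : R).
Hypothesis kn : (k <= n)%N.
Local Notation D := (two_chunk_cyclic_mx n k alpha beta gamma delta).

Lemma sum_self (c t : R) (i : 'I_n) :
  \sum_(j < n) expR (- (t * (if i == j then 0 else c))) = self_sum n c t.
Proof.
under eq_bigr => j _ do rewrite (fun_if (fun x => expR (- (t * x)))) eq_sym.
by rewrite sum_if_const mulr0 oppr0 expR0 card1 card_ord mul1r.
Qed.

(** Vectors constant on the chunks are stable under the zeta matrix, which acts
    on them as the 2 x 2 matrix with rows (A, C) and (C, B). *)
Lemma two_chunk_zetaM (u v t : R) :
  zeta_mx (t *: D) *m col_mx (const_mx u) (const_mx v) =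
  col_mx (const_mx (self_sum n alpha t * u + cross_sum n k gamma delta t * v))
         (const_mx (cross_sum n k gamma delta t * u + self_sum n beta t * v))
  :> 'cV_(n + n).
Proof.
apply/colP => i0; rewrite mxE big_split_ord/=.
under eq_bigr => j _ do rewrite mxE (mxE scalemx_key) col_mxEu [const_mx _ _ _]mxE.
under [X in _ + X]eq_bigr => j _ do
  rewrite mxE (mxE scalemx_key) col_mxEd [const_mx _ _ _]mxE.
rewrite -!mulr_suml -[i0]splitK; case: (fintype.split i0) => i /=.
- rewrite col_mxEu [RHS]mxE; congr (_ * _ + _ * _).
    by rewrite -(sum_self alpha t i); apply: eq_bigr => j _; rewrite block_mxEul mxE.
  under eq_bigr => j _ do
    rewrite block_mxEur mxE (fun_if (fun x => expR (- (t * x)))).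
  by rewrite sum_if_const (card_arc _ _ i kn) card_ord.
- rewrite col_mxEd [RHS]mxE; congr (_ * _ + _ * _); last first.
    by rewrite -(sum_self beta t i); apply: eq_bigr => j _; rewrite block_mxEdr mxE.
  under eq_bigr => j _ do
    rewrite block_mxEdl 2!mxE (fun_if (fun x => expR (- (t * x)))).
  by rewrite sum_if_const (card_arcV _ _ i kn) card_ord.
Qed.

Lemma two_chunk_sym i j : D i j = D j i.
Proof.
rewrite -[i]splitK -[j]splitK; case: (fintype.split i) => {}i; case: (fintype.split j) => {}j /=;
  rewrite ?(block_mxEul, block_mxEur, block_mxEdl, block_mxEdr) !mxE // eq_sym //.
Qed.

Lemma two_chunk_magnitude (t : R) :
  let A := self_sum n alpha t in let B := self_sum n beta t in
  let C := cross_sum n k gamma delta t in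
  A * B - C ^+ 2 != 0 ->
  has_magnitude (t *: D) /\
  magnitude (t *: D) = n%:R * (A + B - 2 * C) / (A * B - C ^+ 2).
Proof.
move=> A B C det0.
(* The weights come from Cramer's rule for A u + C v = C u + B v = 1. *)
pose w : 'cV[R]_(n + n) := col_mx (const_mx ((B - C) / (A * B - C ^+ 2)))
  (const_mx ((A - C) / (A * B - C ^+ 2))).
have wP : is_weighting (t *: D) w.
  rewrite /is_weighting two_chunk_zetaM -/A -/B -/C -col_mx_const.
  by congr (col_mx (const_mx _) (const_mx _)); field.
split; first by exists w.
rewrite (magnitudeE _ wP); last by move=> i j; rewrite !(mxE scalemx_key) two_chunk_sym.
rewrite big_split_ord/=.
under eq_bigr => i _ do rewrite col_mxEu mxE.
under [X in _ + X]eq_bigr => i _ do rewrite col_mxEd mxE.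
by rewrite !sumr_const card_ord -!mulrnDl -mulr_natl; field.
Qed.

(** * The small-scale limit *)

Hypothesis bal : balanced n k alpha beta gamma delta.

Let P (t : R) : R := (self_sum n alpha t + self_sum n beta t
  - 2 * cross_sum n k gamma delta t) / t ^+ 2.

Let E (t : R) : R := (self_sum n alpha t * self_sum n beta t
  - cross_sum n k gamma delta t ^+ 2) / t ^+ 2.

Let p : R := (n%:R - 1) * (alpha ^+ 2 + beta ^+ 2) / 2
  - (k%:R * gamma ^+ 2 + (n%:R - k%:R) * delta ^+ 2).

Let s : R := (n%:R - 1) * (alpha - beta).

Lemma cvg_self_sum (c : R) : self_sum n c t @[t --> 0^'+] --> (n%:R : R).
Proof.
rewrite -[X in _ --> X](_ : 1 + (n%:R - 1) * 1 = n%:R); last by ring.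
by apply: cvgD; [exact: cvg_cst|apply: cvgM; [exact: cvg_cst|exact: cvg_expRNM]].
Qed.

Lemma cvg_self_sumB_slope :
  (self_sum n alpha t - self_sum n beta t) / t @[t --> 0^'+] --> - s.
Proof.
rewrite [X in _ --> X](_ : _ = (n%:R - 1) * (- alpha - - beta)); last by rewrite /s; ring.
apply: cvg_trans (cvgM (cvg_cst _) (cvgB (@expRNM_slope R alpha) (@expRNM_slope R beta))).
apply: near_eq_cvg; near=> t.
have t0 : t != 0 by rewrite gt_eqF.
by rewrite !fctE /= /self_sum; field.
Unshelve. all: by end_near. Qed.

(** For a balanced space, A + B - 2C is the same combination of the remainders
    e^(-ct) - 1 + ct, since the constant terms and the terms of order t of the
    four exponentials cancel; dividing by t^2 then leaves their limits c^2/2. *)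
Lemma cvg_magnitude_numerator : P t @[t --> 0^'+] --> p.
Proof.
rewrite [X in _ --> X](_ : _ = (n%:R - 1) * (alpha ^+ 2 / 2 + beta ^+ 2 / 2)
  - 2 * (k%:R * (gamma ^+ 2 / 2) + (n%:R - k%:R) * (delta ^+ 2 / 2))); last first.
  by rewrite /p; field.
have H := @expRNM_second_order R.
apply: cvg_trans (cvgB (cvgM (cvg_cst _) (cvgD (H alpha) (H beta)))
  (cvgM (cvg_cst _) (cvgD (cvgM (cvg_cst _) (H gamma)) (cvgM (cvg_cst _) (H delta))))).
apply: near_eq_cvg; near=> t.
have t0 : t != 0 by rewrite gt_eqF.
apply/eqP; rewrite -subr_eq0 !fctE /= /P /self_sum /cross_sum; apply/eqP.
move: bal; rewrite /balanced => /eqP; rewrite -subr_eq0 => /eqP bal0.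
(* The two sides differ by the balance defect divided by - t. *)
rewrite -[RHS](mulr0 (- t^-1)) -[X in _ = _ * X]bal0.
by field.
Unshelve. all: by end_near. Qed.

(** Substituting C = (A + B - t^2 P)/2, where P is the normalized numerator,
    turns (AB - C^2)/t^2 into
      P (A + B)/2 - ((A - B)/t)^2/4 - (P t)^2/4,
    each term of which has a limit. *)
Lemma cvg_magnitude_denominator : E t @[t --> 0^'+] --> n%:R * p - s ^+ 2 / 4.
Proof.
pose S t := (self_sum n alpha t - self_sum n beta t) / t.
pose M t := (self_sum n alpha t + self_sum n beta t) / 2.
have cS : S t @[t --> 0^'+] --> - s by exact: cvg_self_sumB_slope.
have cM : M t @[t --> 0^'+] --> (n%:R : R).
  rewrite -[X in _ --> X](_ : (n%:R + n%:R) / 2 = n%:R); last by field.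
  by apply: cvgMr_tmp; apply: cvgD; exact: cvg_self_sum.
have cid : (t : R) @[t --> 0^'+] --> (0 : R).
  by apply: cvg_at_right_filter; exact: cvg_id.
have cP := cvg_magnitude_numerator.
have cPt : P t * t @[t --> 0^'+] --> p * 0 by exact: (cvgM cP cid).
rewrite [X in _ --> X](_ : _ =
  n%:R * p - (- s) * (- s) / 4 - (p * 0) * (p * 0) / 4); last by field.
have : M t * P t - S t * S t / 4 - (P t * t) * (P t * t) / 4 @[t --> 0^'+] -->
    n%:R * p - (- s) * (- s) / 4 - (p * 0) * (p * 0) / 4.
  apply: cvgB; last by apply: cvgMr_tmp; exact: (cvgM cPt cPt).
  apply: cvgB; last by apply: cvgMr_tmp; exact: (cvgM cS cS).
  exact: (cvgM cM cP).
apply: cvg_trans; apply: near_eq_cvg; near=> t.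
have t0 : t != 0 by rewrite gt_eqF.
by rewrite /E /S /M /P; field.
Unshelve. all: by end_near. Qed.

Lemma two_chunk_magnitude_limit0 :
  n%:R * p - s ^+ 2 / 4 != 0 ->
  magnitude_limit0 D (n%:R * p / (n%:R * p - s ^+ 2 / 4)).
Proof.
move=> l0; have cE := cvg_magnitude_denominator.
have E0 : \forall t \near 0^'+, E t != 0 by exact: cvgr_neq0 l0.
have det0 t : E t != 0 -> self_sum n alpha t * self_sum n beta t
  - cross_sum n k gamma delta t ^+ 2 != 0.
  by apply: contraNneq => det; rewrite /E det mul0r.
split.
  by apply: filterS E0 => t /det0 /two_chunk_magnitude[].
have : n%:R * P t / E t @[t --> 0^'+] --> n%:R * p / (n%:R * p - s ^+ 2 / 4).
  apply: cvgM; last exact: cvgV.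
  by apply: cvgM; [exact: cvg_cst|exact: cvg_magnitude_numerator].
apply: cvg_trans; apply: near_eq_cvg; near=> t.
have Et0 : E t != 0 by near: t.
have [_ ->] := two_chunk_magnitude _ (det0 _ Et0).
have t0 : t != 0 by rewrite gt_eqF.
rewrite /E /P; field.
by rewrite t0 det0.
Unshelve. all: by end_near. Qed.

End Magnitude.

(** * Choice of the distances *)

(** A triangle of distinct points is equilateral if it lies inside one chunk;
    otherwise it has one side inside a chunk and two cross sides, whence these
    conditions. *)
Lemma two_chunk_distance_matrix (R : realType) (n k : nat)
    (alpha beta gamma delta : R) :
  0 < alpha -> 0 < beta -> 0 < gamma -> 0 < delta ->
  alpha <= 2 * gamma -> alpha <= 2 * delta ->
  beta <= 2 * gamma -> beta <= 2 * delta ->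
  `|gamma - delta| <= alpha -> `|gamma - delta| <= beta ->
  is_distance_matrix (two_chunk_cyclic_mx n k alpha beta gamma delta).
Proof.
move=> a0 b0 g0 d0 ag ad bg bd; rewrite !ler_distl.
move=> /andP[gda gda'] /andP[gdb gdb'].
have D0 i : two_chunk_cyclic_mx n k alpha beta gamma delta i i = 0.
  rewrite -[i]splitK; case: (fintype.split i) => {}i /=.
    by rewrite block_mxEul mxE eqxx.
  by rewrite block_mxEdr mxE eqxx.
split=> //.
- exact: two_chunk_sym.
- move=> i j; rewrite -[i]splitK -[j]splitK.
  case: (fintype.split i) => {}i; case: (fintype.split j) => {}j /=;
  rewrite ?(block_mxEul, block_mxEur, block_mxEdl, block_mxEdr) !mxE;
  rewrite ?(inj_eq (@lshift_inj _ _)) ?(inj_eq (@rshift_inj _ _)).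
  + by move/negbTE ->.
  + by move=> _; case: ifP.
  + by move=> _; case: ifP.
  + by move/negbTE ->.
- move=> i j l.
  have [<-|il] := eqVneq i l; first by rewrite D0 add0r.
  have [->|lj] := eqVneq l j; first by rewrite D0 addr0.
  move: il lj; rewrite -[i]splitK -[j]splitK -[l]splitK.
  case: (fintype.split i) => {}i; case: (fintype.split j) => {}j;
  case: (fintype.split l) => {}l /=;
  rewrite ?(block_mxEul, block_mxEur, block_mxEdl, block_mxEdr) !mxE;
  rewrite ?(inj_eq (@lshift_inj _ _)) ?(inj_eq (@rshift_inj _ _));
  do ?[move/negbTE ->|move=> _]; repeat case: ifP => _; lra.
Qed.

(** Here N, K and rho stand for n, k and r - 1. The equation on z prescribes the
    denominator of the limit, and amounts to
      K (N - K) z^2 = (N - 1)(1 + x^2 h)  with  h = 1 - (N - 1)/rho.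
    So x has only to be small enough, depending on rho, for x^2 h to be
    negligible; the inequalities are those imposed by the triangles. *)
Lemma exists_parameters (R : realType) (N K rho : R) :
  7 <= N -> 2 <= K -> 2 * K <= N -> rho != 0 ->
  exists x z : R,
    [/\ 0 < x < 1, 0 <= z, z <= 1 - x, 2 * K * z <= 2 * (N - 1) - N * (1 + x)
      & K * (N - K) * z ^+ 2
        = (N - 1) * (1 + x ^+ 2) - (N - 1) ^+ 2 * x ^+ 2 / rho].
Proof.
move=> N7 K2 KN rho0.
set h := 1 - (N - 1) / rho.
(* At x = 0 the squared form 4 (N - 1) <= (N - 2)^2 of the last inequality has
   slack N^2 - 8 N + 8 >= 1, while a perturbation of x and of x^2 h by eps costs
   at most 4 (N - 1) eps + 2 N (N - 2) eps <= 2 N^2 eps. *)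
set eps := (2 * N ^+ 2)^-1.
(* This gives both x <= eps and |x^2 h| <= eps, whatever the size of h. *)
set x := eps / (1 + `|h|).
have N20 : 0 < 2 * N ^+ 2 by nra.
have eps0 : 0 < eps by rewrite invr_gt0.
have epsN : eps * (2 * N ^+ 2) = 1 by rewrite mulVf// gt_eqF.
have eps98 : 98 * eps <= 1 by nra.
have h1 : 1 <= 1 + `|h| by rewrite lerDl.
have x0 : 0 < x by rewrite divr_gt0// (lt_le_trans ltr01).
have xeps : x <= eps by rewrite ler_pdivrMr ?(lt_le_trans ltr01)// ler_peMr// ltW.
have xh : `|x ^+ 2 * h| <= eps.
  have xhE : x * (1 + `|h|) = eps by rewrite divfK// gt_eqF// (lt_le_trans ltr01).
  rewrite normrM ger0_norm ?sqr_ge0//; have := normr_ge0 h; nra.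
move: xh; rewrite ler_norml; set e := x ^+ 2 * h => /andP[e1 e2].
have KNK : 2 * (N - 2) <= K * (N - K) by nra.
have KNK0 : 0 < K * (N - K) by nra.
set y := (N - 1) * (1 + e) / (K * (N - K)).
have yE : K * (N - K) * y = (N - 1) * (1 + e) by rewrite mulrC divfK// gt_eqF.
have y0 : 0 <= y by rewrite divr_ge0 ?(ltW KNK0)// mulr_ge0//; lra.
have zE : Num.sqrt y ^+ 2 = y by rewrite sqr_sqrtr.
(* Since K (N - K) >= 2 (N - 2), at x = 0 one has z^2 <= (N-1)/(2(N-2)) <= 3/5;
   7/10 absorbs the perturbation. *)
have yub : y <= 7 / 10.
  have : 2 * (N - 2) * y <= K * (N - K) * y by exact: ler_wpM2r.
  rewrite yE; nra.
exists x, (Num.sqrt y); split.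
- by rewrite x0/=; lra.
- exact: sqrtr_ge0.
- rewrite -ler_sqr ?nnegrE ?sqrtr_ge0//; last by lra.
  rewrite zE; nra.
- rewrite -ler_sqr ?nnegrE ?mulr_ge0 ?sqrtr_ge0//; last 2 first.
  + lra.
  + nra.
  rewrite exprMn zE.
  (* K <= N - K turns the equation for K (N - K) y into a bound on (K z)^2. *)
  have K2y : K ^+ 2 * y <= (N - 1) * (1 + eps).
    have : K ^+ 2 * y <= K * (N - K) * y by rewrite ler_wpM2r//; nra.
    nra.
  have NN : N * x <= N * eps by rewrite ler_wpM2l//; lra.
  have : (N - 2 - N * eps) ^+ 2 <= (2 * (N - 1) - N * (1 + x)) ^+ 2.
    rewrite ler_sqr ?nnegrE; [lra|nra|nra].
  apply: le_trans.
  rewrite exprMn; nra.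
- rewrite zE yE /e /h; field; exact: rho0.
Qed.

Theorem proposition5p3 (R : realType) (n k : nat)
    (hn : (7 <= n)%N) (hk2 : (2 <= k)%N) (hkn : (k <= n./2)%N)
    (r : R) (hr : r <> 1) :
  exists alpha beta gamma delta : R,
    [/\ 0 < alpha, 0 < beta, 0 < gamma & 0 < delta] /\
    [/\ is_distance_matrix (two_chunk_cyclic_mx n k alpha beta gamma delta),
        balanced n k alpha beta gamma delta
      & magnitude_limit0 (two_chunk_cyclic_mx n k alpha beta gamma delta) r].
Proof.
have kn2 : (2 * k <= n)%N.
  move: hkn; rewrite mul2n -leq_double => /leq_trans; apply.
  by rewrite -[leqRHS]odd_double_half leq_addl.
have kn : (k <= n)%N by rewrite (leq_trans _ kn2)// mul2n -addnn leq_addr.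
have N7 : 7 <= n%:R :> R by rewrite ler_nat.
have K2 : 2 <= k%:R :> R by rewrite ler_nat.
have KN : 2 * k%:R <= n%:R :> R by rewrite -natrM ler_nat.
have rho0 : r - 1 != 0 by rewrite subr_eq0; apply/eqP.
have [x [z [/andP[x0 x1] z0 z1x zK zE]]] := exists_parameters _ _ _ _ N7 K2 KN rho0.
have N0 : n%:R != 0 :> R by rewrite gt_eqF//; lra.
set N : R := n%:R in N7 KN zK zE N0 *; set K : R := k%:R in K2 KN zK zE *.
(* These solve K gamma + (N - K) delta = N - 1 and gamma - delta = z. *)
pose gamma := (N - 1 + (N - K) * z) / N.
pose delta := (N - 1 - K * z) / N.
have gdz : gamma - delta = z by rewrite /gamma /delta; field.
have d2 : 1 + x <= 2 * delta.
  by rewrite /delta mulrA ler_pdivlMr; lra.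
have gd : `|gamma - delta| <= 1 - x by rewrite gdz ger0_norm.
have bal : balanced n k (1 + x) (1 - x) gamma delta.
  by rewrite /balanced -/N -/K /gamma /delta; field.
exists (1 + x), (1 - x), gamma, delta; split; first by split; lra.
split=> //; first by apply: two_chunk_distance_matrix => //; lra.
pose q := (N - 1) ^+ 2 * x ^+ 2.
have q0 : q != 0 by rewrite mulf_neq0 ?expf_neq0// gt_eqF//; lra.
have := two_chunk_magnitude_limit0 _ _ _ _ _ _ kn bal; rewrite -/N -/K.
(* With these distances N p = (N-1)(1+x^2) - K(N-K) z^2 + q and s^2/4 = q, so
   the limit is (q/(r-1) + q) / (q/(r-1)) = r. *)
set p := _ / 2 - _; set s := (N - 1) * _.
have pE : N * p = q / (r - 1) + q.
  have -> : N * p = (N - 1) * (1 + x ^+ 2) - K * (N - K) * z ^+ 2 + q.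
    by rewrite /p /q /gamma /delta; field.
  by rewrite zE /q; ring.
have sE : s ^+ 2 / 4 = q by rewrite /s /q; field.
rewrite pE sE addrK mulf_neq0 ?invr_eq0// => /(_ isT).
suff -> : (q / (r - 1) + q) / (q / (r - 1)) = r by [].
by field; rewrite q0 rho0.
Qed.
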